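(* Let $H$ be a normal subgroup of a finite group $G$ with $G/H$ abelian. Then for all positive integers $k$ we have $$\beta_k(G)\ \ge\ \beta_k(H)+\mathsf{D}(G/H)-1.$$
   Context: Base field: $\mathbb{F}$ is a fixed algebraically closed field whose characteristic does not divide $|G|$. A module over a finite group is a finite dimensional $\mathbb{F}$-vector space with a linear action of the group. For a finite group $K$ and a $K$-module $V$, $\mathbb{F}[V]$ denotes the symmetric algebra of the dual space $V^*$ (a polynomial ring with the standard grading), $\mathbb{F}[V]^K$ is the subalgebra of $K$-invariants, and $\mathbb{F}[V]^K_+$ is the ideal of it spanned by the homogeneous invariants of positive degree. For a positive integer $k$, $\beta_k(K,V)$ is the smallest non-negative integer $s$ such that every homogeneous element of $\mathbb{F}[V]^K$ of degree greater than $s$ lies in $(\mathbb{F}[V]^K_+)^{k+1}$, and $\beta_k(K):=\sup_V\beta_k(K,V)$, where $V$ ranges over all $K$-modules over $\mathbb{F}$. For a finite abelian group $B$ (written additively), a sequence over $B$ is a finite multiset of elements of $B$; it is a zero-sum sequence if the sum of its elements is $0$, and an irreducible zero-sum sequence if it is non-empty, zero-sum, and has no non-empty proper zero-sum subsequence. $\mathsf{D}(B)$ is the Davenport constant of $B$: the maximal length of an irreducible zero-sum sequence over $B$. *)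

(* Defs.v *)
From mathcomp Require Import all_boot all_order all_algebra all_fingroup.
From mathcomp Require Import all_character.
From mathcomp Require mpoly boolp classical_sets reals constructive_ereal ereal.

Set Implicit Arguments.
Unset Strict Implicit.
Unset Printing Implicit Defensive.

Import GRing.Theory.

(* The notations of mpoly and of classical_sets cannot be active together:   *)
(* each of the two modules below imports only one of these libraries.        *)
Module Invariants.

Import mpoly.
Local Open Scope ring_scope.

Definition lin_span (F : fieldType) (V : lmodType F) (S : V -> Prop) (v : V) :
    Prop :=
  exists s : seq (F * V),
    (forall x, x \in s -> S x.2) /\ v = \sum_(x <- s) x.1 *: x.2.

Section Invariants.
Variables (F : fieldType) (gT : finGroupType) (G : {group gT}) (n : nat).
Variable rG : mx_representation F G n.

(* The module V is 'rV[F]_n, on which g acts by v |-> v *m rG g; the variable *)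
(* 'X_i of F[V] is the i-th coordinate function, so that (mpoly_act g f)(v) = *)
(* f(v *m rG g).  Acting on the right instead of on the left amounts to       *)
(* replacing g by its inverse, which does not affect invariance under G.      *)
Definition mpoly_act (g : gT) (f : {mpoly F[n]}) : {mpoly F[n]} :=
  comp_mpoly [tuple \sum_(j < n) rG g j i *: 'X_j | i < n] f.

Definition invariant (f : {mpoly F[n]}) : Prop :=
  forall g, g \in G -> mpoly_act g f = f.

Definition invariant_plus : {mpoly F[n]} -> Prop :=
  lin_span (fun f => invariant f /\ exists2 d, (0 < d)%N & f \is d.-homog).

(* Powers of invariant_plus as an ideal of the ring of invariants. *)
Fixpoint invariant_plus_pow (m : nat) : {mpoly F[n]} -> Prop :=
  if m is m'.+1 then
    lin_span (fun f => exists a b,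
      [/\ invariant_plus a, invariant_plus_pow m' b & f = a * b])
  else invariant.

Definition beta_bound (k s : nat) : Prop :=
  forall (d : nat) (f : {mpoly F[n]}),
    (s < d)%N -> f \is d.-homog -> invariant f -> invariant_plus_pow k.+1 f.

End Invariants.

End Invariants.

Module Constants.

Import boolp classical_sets reals constructive_ereal ereal.
Export Invariants.
Local Open Scope classical_set_scope.
Local Open Scope ring_scope.

Section Constants.
Variable R : realType.

(* The constants take values in the extended reals, so that minima, maxima    *)
(* and suprema are total: the infimum of a nonempty set of natural numbers is *)
(* its minimum, and the supremum of a nonempty bounded one its maximum.       *)
Definition nat_ereal (s : nat) : \bar R := (s%:R)%:E.

Definition beta_rep (F : fieldType) (gT : finGroupType) (G : {group gT})
    (k n : nat) (rG : mx_representation F G n) : \bar R :=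
  ereal_inf (nat_ereal @` [set s | beta_bound rG k s]).

Definition beta (F : fieldType) (gT : finGroupType) (G : {group gT})
    (k : nat) : \bar R :=
  ereal_sup [set x | exists (n : nat) (rG : mx_representation F G n),
                       x = beta_rep k rG].

(* Zero-sum sequences over an abelian B, in multiplicative notation.  A       *)
(* multiset is represented by any list enumerating it: as B is abelian, the   *)
(* order is irrelevant, and the submultisets are those listed by subseqs.     *)
Definition zero_sum (gT : finGroupType) (s : seq gT) : Prop :=
  (\prod_(x <- s) x = 1)%g.

Definition irreducible_zero_sum (gT : finGroupType) (B : {set gT})
    (s : seq gT) : Prop :=
  [/\ {subset s <= B}, s != [::], zero_sum s &
      forall t, subseq t s -> t != [::] -> t != s -> ~ zero_sum t].

Definition davenport (gT : finGroupType) (B : {set gT}) : \bar R :=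
  ereal_sup [set nat_ereal (size s) | s in irreducible_zero_sum B].

End Constants.

End Constants.

Export Constants.

(* Main.v *)
Require Import Defs.
From HB Require Import structures.
From mathcomp Require Import all_boot all_order all_algebra all_fingroup.
From mathcomp Require Import all_solvable all_field all_character.
From mathcomp Require mpoly boolp reals constructive_ereal ereal.

(** Let W be an H-module and f a homogeneous H-invariant on W, of degree d > 0,
    that is not in the (k+1)-st power of the ideal of invariants of positive
    degree. Let s_0, s_1, ..., s_m be an irreducible zero-sum sequence over the
    abelian group G / H. It suffices to find a G-module Z and a homogeneous
    G-invariant on Z, of degree d + m, that is not in the corresponding
    (k+1)-st power.

    Characters. The order of G / H is invertible in the algebraically closed
    field F, so that G / H is isomorphic to its character group; in the form
    used here, G / H has a nondegenerate pairing with itself with values in the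
    multiplicative group of F ([abelian_dual_pairing]). Pairing with s_0 gives a
    linear character chi of G that is trivial on H, pairing with s_1, ..., s_m
    gives further ones lam_1, ..., lam_m; the product of all of them is trivial,
    while no nonempty subproduct of the lam_l is.

    The module. Let V be the module of all functions from the ambient group to
    W, with G acting by translations. It contains W as an H-direct summand, with
    inclusion iota (w goes to the function x |-> w x on H, extended by 0) and
    retraction pi (an average over H), and the composite of iota, the action of
    g and pi is the action of g on W if g is in H and 0 otherwise
    ([coind_inH], [coind_in_out]). Take Z = V + U, where U is the sum of the
    one-dimensional modules on which G acts by lam_1, ..., lam_m, with
    coordinates x_1, ..., x_m.

    The invariant. The sum over g in G of chi(g)^-1 (g . (f o pi)) has weight
    chi, so that its product h with x_1 ... x_m is G-invariant of degree d + m.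
    The restriction to W of the first factor is |H| f, because d > 0 makes the
    terms with g outside H vanish.

    Why h is not in the (k+1)-st power. Restrict an element of F[Z] to W + U and
    take the coefficient in F[W] of a squarefree monomial x^mu. When the element
    is a G-invariant of positive degree, this coefficient is an H-invariant with
    zero constant term: a nonzero constant term would be the coefficient of x^mu
    in a G-invariant on U without constant term, thus mu <> 0 and the lam_l with
    l in the support of mu would have a trivial product ([ext_coeff_plus]). As
    all divisors of a squarefree monomial are squarefree, the coefficients of
    x^mu in the (k+1)-st power for Z are in the (k+1)-st power for W
    ([ext_coeff_pow]). The coefficient of x_1 ... x_m in h is |H| f, which is
    not.

    Since k > 0, the coordinate of the trivial module is not in the (k+1)-st
    power, so that invariants f as above always exist. The inequality of
    constants follows by varying W, f and the sequence. *)

Module LowerBound.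
Import mpoly GRing.Theory.
Import Invariants.
Set Implicit Arguments.
Unset Strict Implicit.
Unset Printing Implicit Defensive.
Local Open Scope ring_scope.

(** * Linear substitutions in polynomials *)

Lemma mpoly_rmorph_ext (A S : comNzRingType) n
    (phi psi : {rmorphism {mpoly A[n]} -> S}) :
    (forall c, phi c%:MP = psi c%:MP) -> (forall i, phi 'X_i = psi 'X_i) ->
  phi =1 psi.
Proof.
move=> eqC eqX p; rewrite [p]mpolyE !rmorph_sum; apply: eq_bigr => mu _.
rewrite -mul_mpolyC !rmorphM eqC mpolyXE_id !rmorph_prod; congr (_ * _).
by apply: eq_bigr => i _; rewrite !rmorphXn eqX.
Qed.

Section LinSubst.
Variable F : fieldType.

(** The comorphism F[V] -> F[U] of the linear map u |-> u *m M from U = F^m to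
    V = F^n (row vectors); thus [mpoly_act rG g] is [lin_subst (rG g)]. *)
Definition lin_subst m n (M : 'M[F]_(m, n)) (p : {mpoly F[n]}) : {mpoly F[m]} :=
  p \mPo [tuple \sum_(j < m) M j i *: 'X_j | i < n].

HB.instance Definition _ m n (M : 'M[F]_(m, n)) :=
  GRing.RMorphism.copy (lin_subst M) (comp_mpoly _).
HB.instance Definition _ m n (M : 'M[F]_(m, n)) :=
  GRing.Linear.copy (lin_subst M) (comp_mpoly _).

Lemma lin_substC m n (M : 'M[F]_(m, n)) c : lin_subst M c%:MP = c%:MP.
Proof. exact: comp_mpolyC. Qed.

Lemma lin_substX m n (M : 'M[F]_(m, n)) i :
  lin_subst M 'X_i = \sum_(j < m) M j i *: 'X_j.
Proof. by rewrite /lin_subst comp_mpolyXU -tnth_nth tnth_mktuple. Qed.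

Lemma lin_subst_mulmx m n r (M : 'M[F]_(m, n)) (N : 'M[F]_(n, r)) p :
  lin_subst (M *m N) p = lin_subst M (lin_subst N p).
Proof.
rewrite -[RHS]/((lin_subst M \o lin_subst N) p).
apply: mpoly_rmorph_ext => [c|i] /=; first by rewrite !lin_substC.
rewrite !lin_substX linear_sum /=.
under eq_bigr do rewrite mxE scaler_suml.
rewrite exchange_big; apply: eq_bigr => j _ /=.
rewrite linearZ /= lin_substX scaler_sumr; apply: eq_bigr => l _.
by rewrite scalerA mulrC.
Qed.

Lemma lin_subst1 n (p : {mpoly F[n]}) : lin_subst 1%:M p = p.
Proof.
rewrite -[RHS]/(idfun p); apply: mpoly_rmorph_ext => [c|i] /=.
  exact: lin_substC.
rewrite lin_substX (bigD1 i) //= big1 => [|j /negPf ne_ji].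
  by rewrite mxE eqxx scale1r addr0.
by rewrite mxE ne_ji scale0r.
Qed.

Lemma lin_subst0 m n d (p : {mpoly F[n]}) :
  (0 < d)%N -> p \is d.-homog -> lin_subst (0 : 'M[F]_(m, n)) p = 0.
Proof.
move=> d_gt0 homp; rewrite [p]mpolyE linear_sum big_seq big1 //= => mu.
move/(dhomog_mf homp) => deg_mu; rewrite linearZ /= mpolyXE_id rmorph_prod.
have [i mu_i | mu0] := pickP (fun i => mu i != 0%N).
  rewrite (bigD1 i) //= rmorphXn /= lin_substX big1 => [|j _].
    by rewrite expr0n (negPf mu_i) mul0r scaler0.
  by rewrite mxE scale0r.
move: d_gt0; rewrite -deg_mu /= mdegE big1 // => i _.
by apply/eqP/negbFE/mu0.
Qed.

Lemma dhomog_lin_subst m n (M : 'M[F]_(m, n)) d p :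
  p \is d.-homog -> lin_subst M p \is d.-homog.
Proof.
move=> homp; rewrite [p]mpolyE linear_sum big_seq rpred_sum // => mu.
move/(dhomog_mf homp) => /= deg_mu; rewrite linearZ rpredZ //= mpolyXE_id.
rewrite rmorph_prod -deg_mu mdegE /=.
elim/big_rec2: _ => [|i e q _ homq]; first exact: dhomog1.
apply: dhomogM => //; rewrite rmorphXn /= lin_substX -[X in X.-homog]mul1n.
apply: dhomogMn; apply: rpred_sum => j _; rewrite rpredZ // dhomogX.
exact/eqP/mdeg1.
Qed.

Lemma pihomog_lin_subst m n (M : 'M[F]_(m, n)) d p :
  pihomog mdeg d (lin_subst M p) = lin_subst M (pihomog mdeg d p).
Proof.
(* Any bound on the degrees that exceeds d makes the d-component one of the
   terms of the partition. *)
pose k := maxn (msize p) d.+1; have lt_dk : (d < k)%N := leq_maxr _ _.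
have Ep : p = \sum_(e < k) pihomog mdeg e p.
  by rewrite -pihomog_partitionE ?leq_maxl.
transitivity (pihomog mdeg d (\sum_(e < k) lin_subst M (pihomog mdeg e p))).
  by congr (pihomog _ _ _); rewrite {1}Ep linear_sum.
rewrite raddf_sum (bigD1 (Ordinal lt_dk)) //= big1 => [|e ne_ed].
  by rewrite addr0 pihomog_dE // dhomog_lin_subst // pihomogP.
apply: (@pihomog_ne0 _ _ _ e d); last by rewrite dhomog_lin_subst // pihomogP.
exact: ne_ed.
Qed.

Lemma mcoeff_lin_subst_diag m (d : 'rV[F]_m) p mu :
  (lin_subst (diag_mx d) p)@_mu = (\prod_i d 0 i ^+ mu i) * p@_mu.
Proof.
have substX nu : lin_subst (diag_mx d) 'X_[nu] =
    (\prod_i d 0 i ^+ nu i) *: 'X_[nu].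
  rewrite [in LHS]mpolyXE_id rmorph_prod [in RHS]mpolyXE_id -scaler_prod.
  apply: eq_bigr => i _; rewrite rmorphXn /= lin_substX (bigD1 i) //=.
  rewrite big1 => [|j /negPf ne_ji]; last by rewrite mxE ne_ji scale0r.
  by rewrite addr0 mxE eqxx exprZn.
rewrite [p in LHS]mpolyE (linear_sum (lin_subst _)) (linear_sum (mcoeff mu)).
rewrite [p in RHS]mpolyE (linear_sum (mcoeff mu)) mulr_sumr.
apply: eq_bigr => nu _ /=; rewrite linearZ /= substX !mcoeffZ mcoeffX.
by case: eqP => [->|_]; rewrite ?mulr0 // mulr1 mulrC mulr1.
Qed.

(** * Separation of variables *)

(** The isomorphism between F[V + U] and F[V][U], for V of dimension [n] and U
    of dimension [m]: the first [n] variables go to the coefficient ring. *)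
Definition split_mpoly n m : {mpoly F[n + m]} -> {mpoly {mpoly F[n]}[m]} :=
  mmap (@mpolyC m {mpoly F[n]} \o @mpolyC n F)
    (fun i => match fintype.split i with
              | inl j => ('X_j)%:MP
              | inr l => 'X_l
              end).

HB.instance Definition _ n m :=
  GRing.RMorphism.copy (@split_mpoly n m)
    (mmap (@mpolyC m {mpoly F[n]} \o @mpolyC n F) _).

Lemma split_mpolyC n m c : @split_mpoly n m c%:MP = c%:MP%:MP.
Proof. exact: mmapC. Qed.

Lemma split_mpolyXl n m j : @split_mpoly n m 'X_(lshift m j) = ('X_j)%:MP.
Proof. by rewrite /split_mpoly mmapX mmap1U (unsplitK (inl j)). Qed.

Lemma split_mpolyXr n m l : @split_mpoly n m 'X_(rshift n l) = 'X_l.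
Proof. by rewrite /split_mpoly mmapX mmap1U (unsplitK (inr l)). Qed.

Lemma split_mpolyZ n m c p :
  @split_mpoly n m (c *: p) = c%:MP *: split_mpoly p.
Proof. by rewrite -!mul_mpolyC rmorphM /= split_mpolyC. Qed.

(** A linear map of the first summand acts on the coefficients. *)
Lemma split_mpoly_block n N m (A : 'M[F]_(n, N)) (p : {mpoly F[N + m]}) :
  split_mpoly (lin_subst (block_mx A 0 0 1%:M) p) =
  map_mpoly (lin_subst A) (split_mpoly p).
Proof.
rewrite -[LHS]/((@split_mpoly n m \o lin_subst _) p).
rewrite -[RHS]/((map_mpoly (lin_subst A) \o @split_mpoly N m) p).
apply: mpoly_rmorph_ext => [c|i] /=.
  by rewrite lin_substC !split_mpolyC map_mpolyC /= lin_substC.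
rewrite lin_substX rmorph_sum big_split_ord /=.
rewrite -[i]splitK; case: (fintype.split i) => [j|l] /=.
  rewrite [X in _ + X]big1 => [|t _]; last first.
    by rewrite block_mxEdl mxE scale0r rmorph0.
  rewrite addr0 split_mpolyXl map_mpolyC /= lin_substX rmorph_sum /=.
  apply: eq_bigr => t _.
  rewrite block_mxEul split_mpolyZ split_mpolyXl -mul_mpolyC -rmorphM.
  by rewrite mul_mpolyC.
rewrite big1 => [|t _]; last by rewrite block_mxEur mxE scale0r rmorph0.
rewrite add0r split_mpolyXr map_mpolyX (bigD1 l) //= big1 => [|t /negPf ne_tl].
  by rewrite block_mxEdr mxE eqxx scale1r split_mpolyXr addr0.
by rewrite block_mxEdr mxE ne_tl scale0r rmorph0.
Qed.

Lemma split_mpoly_embed n m (p : {mpoly F[n]}) :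
  split_mpoly (lin_subst (col_mx 1%:M 0 : 'M_(n + m, n)) p) = p%:MP.
Proof.
rewrite -[LHS]/((@split_mpoly n m \o lin_subst _) p).
apply: mpoly_rmorph_ext => [c|i] /=; first by rewrite lin_substC split_mpolyC.
rewrite lin_substX rmorph_sum big_split_ord /=.
rewrite [X in _ + X]big1 => [|l _]; last first.
  by rewrite col_mxEd mxE scale0r rmorph0.
rewrite addr0 (bigD1 i) //= big1 => [|j /negPf ne_ji].
  by rewrite addr0 col_mxEu mxE eqxx scale1r split_mpolyXl.
by rewrite col_mxEu mxE ne_ji scale0r rmorph0.
Qed.

(** The constant terms of the coefficients of [split_mpoly p] are the
    coefficients of the restriction of [p] to the last summand. *)
Lemma split_mpoly_const n m (p : {mpoly F[n + m]}) mu :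
  (split_mpoly p)@_mu@_0%MM = (lin_subst (row_mx 0 1%:M) p)@_mu.
Proof.
rewrite -(mcoeff_map_mpoly (mcoeff 0%MM)); congr (mcoeff _ _).
rewrite -[LHS]/((map_mpoly (mcoeff 0%MM) \o @split_mpoly n m) p).
apply: mpoly_rmorph_ext => [c|i] /=.
  by rewrite lin_substC split_mpolyC map_mpolyC /= mcoeffC eqxx mulr1.
rewrite lin_substX -[i]splitK; case: (fintype.split i) => [j|l] /=.
  rewrite split_mpolyXl map_mpolyC /= mcoeffX mnm1_eq0 big1 ?mpolyC0 // => t _.
  by rewrite row_mxEl mxE scale0r.
rewrite split_mpolyXr map_mpolyX (bigD1 l) //= big1 => [|t /negPf ne_tl].
  by rewrite row_mxEr mxE eqxx scale1r addr0.
by rewrite row_mxEr mxE ne_tl scale0r.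
Qed.

End LinSubst.

(** * Linear spans and powers of the ideal of invariants *)

Section LinSpan.
Variables (F : fieldType) (V : lmodType F) (S : V -> Prop).

Lemma lin_span_in v : S v -> lin_span S v.
Proof.
move=> Sv; exists [:: (1, v)]; rewrite big_seq1 scale1r; split=> // x.
by rewrite inE => /eqP->.
Qed.

Lemma lin_span0 : lin_span S 0.
Proof. by exists [::]; rewrite big_nil; split. Qed.

Lemma lin_spanD u v : lin_span S u -> lin_span S v -> lin_span S (u + v).
Proof.
case=> s [Ss ->] [t [St ->]]; exists (s ++ t); rewrite big_cat; split=> // x.
by rewrite mem_cat => /orP[/Ss | /St].
Qed.

Lemma lin_spanZ c v : lin_span S v -> lin_span S (c *: v).
Proof.
case=> s [Ss ->]; exists [seq (c * x.1, x.2) | x <- s]; split=> [x|].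
  by case/mapP=> y /Ss Sy ->.
by rewrite big_map scaler_sumr; apply: eq_bigr => x _; rewrite scalerA.
Qed.

Lemma lin_span_sum (I : Type) (r : seq I) (P : pred I) (f : I -> V) :
  (forall i, P i -> lin_span S (f i)) -> lin_span S (\sum_(i <- r | P i) f i).
Proof.
move=> Sf; elim/big_ind: _ => //; [exact: lin_span0 | exact: lin_spanD].
Qed.

Lemma lin_span_ind (P : V -> Prop) :
    P 0 -> (forall u v, P u -> P v -> P (u + v)) ->
    (forall c v, P v -> P (c *: v)) -> (forall v, S v -> P v) ->
  forall v, lin_span S v -> P v.
Proof.
move=> P0 PD PZ PS v [s [Ss ->]]; rewrite big_seq.
by elim/big_ind: _ => // x /Ss/PS; apply: PZ.
Qed.

End LinSpan.

Section InvariantPowers.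
Variables (F : fieldType) (gT : finGroupType) (G : {group gT}) (n : nat).
Variable rG : mx_representation F G n.
Implicit Types p q : {mpoly F[n]}.

Lemma mpoly_actE g p : mpoly_act rG g p = lin_subst (rG g) p.
Proof. by []. Qed.

Lemma invariant_plus_powZ m c p :
  invariant_plus_pow rG m p -> invariant_plus_pow rG m (c *: p).
Proof.
case: m => [|m]; last exact: lin_spanZ.
by move=> invp g Gg; rewrite mpoly_actE linearZ /= -mpoly_actE invp.
Qed.

(** The homogeneous components of an invariant are invariants, because the
    group acts by linear substitutions. *)
Lemma invariant_plus_const0 p :
  invariant rG p -> p@_0%MM = 0 -> invariant_plus rG p.
Proof.
move=> invp p0; rewrite (pihomog_partitionE (mf := mdeg) (leqnn (msize p))).
apply: lin_span_sum => /= -[[|d] /= lt_d] _; last first.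
  apply: lin_span_in; split=> [g Gg|]; last by exists d.+1; rewrite ?pihomogP.
  by rewrite mpoly_actE -pihomog_lin_subst -mpoly_actE invp.
rewrite pihomogE big1 => [|mu]; first exact: lin_span0.
by rewrite mdeg_eq0 => /eqP->; rewrite p0 scale0r.
Qed.

Lemma invariant_plus_mcoeff0 p : invariant_plus rG p -> p@_0%MM = 0.
Proof.
move: p; apply: lin_span_ind => [|p q|c p|p [_ [d d_gt0 homp]]].
- exact: mcoeff0.
- by rewrite mcoeffD => -> ->; rewrite addr0.
- by rewrite mcoeffZ => ->; rewrite mulr0.
by apply: (dhomog_nemf_coeff homp); rewrite /= mdeg0 neq_ltn d_gt0.
Qed.

(** Elements of the [j]-th power have no term of degree less than [j]. *)
Lemma invariant_plus_pow_mcoeff j p mu :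
  invariant_plus_pow rG j p -> (mdeg mu < j)%N -> p@_mu = 0.
Proof.
elim: j p mu => [//|j IHj] p mu pow_p lt_mu; move: p pow_p.
apply: lin_span_ind => [|p q|c p|_ [a [b [plus_a pow_b ->]]]].
- exact: mcoeff0.
- by rewrite mcoeffD => -> ->; rewrite addr0.
- by rewrite mcoeffZ => ->; rewrite mulr0.
rewrite mcoeffM big1 // => -[ka kb] /= /eqP Emu.
have [a0 | nz_ka] := eqVneq (bmnm ka) 0%MM.
  by rewrite a0 (invariant_plus_mcoeff0 plus_a) mul0r.
rewrite (IHj _ kb pow_b) ?mulr0 //.
rewrite -mdeg_eq0 -lt0n in nz_ka.
apply: leq_trans (leq_add nz_ka (leqnn (mdeg kb))) _.
by rewrite -ltnS -mdegD -Emu.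
Qed.

End InvariantPowers.

(** The coordinate of the trivial module of dimension 1 has degree 1 and is not
    in the ([k] + 1)-st power when [k] is positive. *)
Lemma trivial_not_beta_bound (F : fieldType) (gT : finGroupType)
    (H : {group gT}) k :
  (0 < k)%N -> exists n (rW : mx_representation F H n), ~ beta_bound rW k 0.
Proof.
move=> k_gt0; have triv : mx_repr H (fun _ => 1%:M : 'M[F]_1).
  by split=> // x y _ _; rewrite mulmx1.
exists 1%N, (MxRepresentation triv) => bound0.
have homX : ('X_ord0 : {mpoly F[1]}) \is 1.-homog.
  by rewrite dhomogX; apply/eqP/mdeg1.
have invX : invariant (MxRepresentation triv) 'X_ord0.
  by move=> g _; rewrite mpoly_actE lin_subst1.
have := invariant_plus_pow_mcoeff (mu := U_(ord0)%MM) (bound0 _ _ _ homX invX).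
by rewrite mdeg1 mcoeffX eqxx => /(_ isT k_gt0)/eqP; rewrite oner_eq0.
Qed.

(** * Extending an invariant of a normal subgroup *)

Lemma diag_mx_repr (F : fieldType) (gT : finGroupType) (G : {group gT}) m
    (lam : 'I_m -> gT -> F) :
    (forall l, lam l 1%g = 1) ->
    (forall l, {in G &, {morph lam l : x y / (x * y)%g >-> x * y}}) ->
  mx_repr G (fun g => diag_mx (\row_l lam l g)).
Proof.
move=> lam1 lamM; split=> [|x y Gx Gy].
  by apply/matrixP=> i j; rewrite !mxE lam1.
rewrite mulmx_diag; congr diag_mx; apply/rowP=> l.
by rewrite !mxE lamM.
Qed.

(** The module V is given by the representation [rV] of [G], and W by the
    representation [rW] of [H]; the matrices [iota] and [pi] make W a direct
    summand of V. *)
Section Extension.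
Variables (F : fieldType) (gT : finGroupType) (G H : {group gT}).
Hypothesis sHG : H \subset G.
Variables (n N m : nat).
Variables (rW : mx_representation F H n) (rV : mx_representation F G N).
Variables (iota : 'M[F]_(n, N)) (pi : 'M[F]_(N, n)).
Hypothesis iotaH : {in H, forall h, iota *m rV h = rW h *m iota}.
Hypothesis iota_pi :
  {in G, forall g, iota *m rV g *m pi = if g \in H then rW g else 0}.
Variables (chi : gT -> F) (lam : 'I_m -> gT -> F).
Hypothesis chi1 : {in H, forall h, chi h = 1}.
Hypothesis chiM : {in G &, {morph chi : x y / (x * y)%g >-> x * y}}.
Hypothesis lam1 : forall l, {in H, forall h, lam l h = 1}.
Hypothesis lamM :
  forall l, {in G &, {morph lam l : x y / (x * y)%g >-> x * y}}.
Hypothesis chi_lam : {in G, forall g, chi g * \prod_l lam l g = 1}.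
Hypothesis lam_free : forall mu : 'X_{1..m}, (forall l, (mu l <= 1)%N) ->
  {in G, forall g, \prod_l lam l g ^+ mu l = 1} -> mu = 0%MM.

Let rU := MxRepresentation (diag_mx_repr (fun l => lam1 l (group1 H)) lamM).

(** The representation on Z = V + U, where [G] acts on U by the characters
    [lam l]. *)
Definition ext_repr : mx_representation F G (N + m) :=
  MxRepresentation (add_mx_repr (Representation rV) (Representation rU)).

(* The inclusion of W + U in V + U. *)
Let B : 'M[F]_(n + m, N + m) := block_mx iota 0 0 1%:M.

(** The coefficient of the monomial [mu] in the restriction to W + U of a
    polynomial on V + U. *)
Definition ext_coeff mu (p : {mpoly F[N + m]}) : {mpoly F[n]} :=
  (split_mpoly (lin_subst B p))@_mu.

Lemma ext_coeffD mu p q :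
  ext_coeff mu (p + q) = ext_coeff mu p + ext_coeff mu q.
Proof. by rewrite /ext_coeff !rmorphD mcoeffD. Qed.

Lemma ext_coeffZ mu c p : ext_coeff mu (c *: p) = c *: ext_coeff mu p.
Proof. by rewrite /ext_coeff linearZ /= split_mpolyZ mcoeffZ mul_mpolyC. Qed.

Lemma ext_coeff0 mu : ext_coeff mu 0 = 0.
Proof. by rewrite -(scale0r 0) ext_coeffZ scale0r. Qed.

Lemma ext_coeff_invariant mu p :
  invariant ext_repr p -> invariant rW (ext_coeff mu p).
Proof.
move=> invp h Hh; have Gh := subsetP sHG h Hh.
rewrite mpoly_actE /ext_coeff -(mcoeff_map_mpoly (lin_subst (rW h))).
rewrite -split_mpoly_block -[in RHS](invp h Gh) mpoly_actE.
rewrite -!lin_subst_mulmx /=; congr (split_mpoly (lin_subst _ p))@_mu.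
rewrite !mulmx_block !(mulmx0, mul0mx, addr0, add0r, mul1mx, mulmx1) iotaH //.
congr block_mx; apply/matrixP=> i j.
by rewrite !mxE lam1.
Qed.

(** For invariants of positive degree, the coefficient of a squarefree monomial
    has no constant term: otherwise the characters [lam l] with [mu l = 1] would
    have a trivial product. *)
Lemma ext_coeff_plus (mu : 'X_{1..m}) p : (forall l, (mu l <= 1)%N) ->
  invariant_plus ext_repr p -> invariant_plus rW (ext_coeff mu p).
Proof.
move=> mu_le1; move: p; apply: lin_span_ind.
- by rewrite ext_coeff0; apply: lin_span0.
- by move=> p q IHp IHq; rewrite ext_coeffD; exact: (lin_spanD IHp IHq).
- by move=> c p IHp; rewrite ext_coeffZ; exact: (lin_spanZ _ IHp).
move=> p [invp [d d_gt0 homp]].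
apply: invariant_plus_const0; first exact: ext_coeff_invariant.
rewrite split_mpoly_const -lin_subst_mulmx mul_row_block.
rewrite !(mul0mx, mulmx0, mul1mx, addr0, add0r).
(* q is the restriction of p to U. *)
set q := lin_subst _ p; have homq : q \is d.-homog by apply: dhomog_lin_subst.
apply/eqP/contraT => nz_qmu; suff mu0 : mu = 0%MM.
  case/eqP: nz_qmu; rewrite mu0; apply: (dhomog_nemf_coeff homq).
  by rewrite /= mdeg0 neq_ltn d_gt0.
apply: lam_free => // g Gg; apply: (mulIf nz_qmu); rewrite mul1r.
(* As q is invariant, g multiplies its coefficient at mu by 1. *)
rewrite -[in RHS](_ : lin_subst (diag_mx (\row_l lam l g)) q = q).
  rewrite mcoeff_lin_subst_diag; congr (_ * _).
  by apply: eq_bigr => l _; rewrite mxE.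
rewrite /q -[in RHS](invp g Gg) mpoly_actE -!lin_subst_mulmx.
rewrite mul_row_block mul_mx_row.
by rewrite !(mul0mx, mulmx0, mul1mx, mulmx1, addr0, add0r).
Qed.

Lemma ext_coeff_pow j (mu : 'X_{1..m}) p : (forall l, (mu l <= 1)%N) ->
  invariant_plus_pow ext_repr j p -> invariant_plus_pow rW j (ext_coeff mu p).
Proof.
elim: j mu p => [|j IHj] mu p mu_le1; first exact: ext_coeff_invariant.
move: p; apply: lin_span_ind.
- by rewrite ext_coeff0; apply: lin_span0.
- by move=> p q IHp IHq; rewrite ext_coeffD; exact: (lin_spanD IHp IHq).
- by move=> c p IHp; rewrite ext_coeffZ; exact: (lin_spanZ _ IHp).
move=> _ [a [b [plus_a pow_b ->]]].
rewrite /ext_coeff !rmorphM mcoeffM.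
apply: lin_span_sum => -[ka kb] /= /eqP Emu.
have Emul l : mu l = (ka l + kb l)%N.
  by move/(congr1 (fun nu : 'X_{1..m} => nu l)): Emu; rewrite mnmDE.
apply: lin_span_in; exists (ext_coeff ka a), (ext_coeff kb b).
split=> //; [apply: ext_coeff_plus | apply: IHj] => // l.
all: apply: leq_trans (mu_le1 l); rewrite Emul ?leq_addr ?leq_addl //.
Qed.

Section Witness.
Variables (d : nat) (f : {mpoly F[n]}).
Hypotheses (d_gt0 : (0 < d)%N) (homf : f \is d.-homog) (invf : invariant rW f).

(** The [chi]-component of the translates of f o pi, multiplied by the product
    of the coordinates of U. *)
Definition ext_witness : {mpoly F[N + m]} :=
  (\sum_(g in G) (chi g)^-1 *:
     lin_subst (ext_repr g *m col_mx pi 0) f) * \prod_l 'X_(rshift N l).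

Lemma ext_witness_homog : ext_witness \is (d + m).-homog.
Proof.
apply: dhomogM.
  by apply: rpred_sum => g _; rewrite rpredZ // dhomog_lin_subst.
rewrite -[m in m.-homog]card_ord -sum1_card.
elim/big_rec2: _ => [|l e q _ homq]; first exact: dhomog1.
by apply: dhomogM => //; rewrite dhomogX; apply/eqP/mdeg1.
Qed.

Lemma ext_witness_invariant : invariant ext_repr ext_witness.
Proof.
move=> g Gg; rewrite mpoly_actE /ext_witness rmorphM rmorph_prod /=.
have chi_nz x : x \in G -> chi x != 0.
  move=> Gx; apply: contra_eq_neq (chi_lam Gx) => ->.
  by rewrite mul0r eq_sym oner_neq0.
have ->: \prod_l lin_subst (ext_repr g) 'X_(rshift N l) =
    (\prod_l lam l g) *: \prod_l 'X_(rshift N l).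
  rewrite -scaler_prod; apply: eq_bigr => l _.
  rewrite lin_substX big_split_ord /= big1 ?add0r => [|j _]; last first.
    by rewrite block_mxEur mxE scale0r.
  rewrite (bigD1 l) //= big1 => [|t /negPf ne_tl].
    by rewrite addr0 block_mxEdr !mxE eqxx.
  by rewrite block_mxEdr !mxE ne_tl scale0r.
rewrite -scalerAr scalerAl; congr (_ * _).
rewrite (linear_sum (lin_subst _)) scaler_sumr [RHS](reindex_inj (mulgI g)) /=.
apply: eq_big => [x|x Gx]; first by rewrite groupMl.
rewrite linearZ /= -lin_subst_mulmx mulmxA.
rewrite -(repr_mxM ext_repr Gg Gx) scalerA; congr (_ *: _).
rewrite chiM // invfM; congr (_ * _).
by apply: (mulfI (chi_nz g Gg)); rewrite chi_lam // divff ?chi_nz.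
Qed.

Lemma ext_coeff_witness :
  ext_coeff [multinom 1%N | _ < m] ext_witness = #|H|%:R *: f.
Proof.
have Esum : lin_subst B (\sum_(g in G) (chi g)^-1 *:
       lin_subst (ext_repr g *m col_mx pi 0) f) =
    lin_subst (col_mx 1%:M 0) (#|H|%:R *: f).
  rewrite (linear_sum (lin_subst _)) (big_setID H) /= (setIidPr sHG).
  rewrite [X in _ + X]big1.
    rewrite addr0 (eq_bigr (fun=> lin_subst (col_mx 1%:M 0) f)) => [|h Hh].
      by rewrite sumr_const linearZ /= scaler_nat.
    have Gh := subsetP sHG h Hh.
    rewrite linearZ /= chi1 // invr1 scale1r -lin_subst_mulmx mulmxA.
    rewrite mulmx_block mul_block_col !(mulmx0, mul0mx, addr0, add0r, mul1mx).
    rewrite iota_pi // Hh -[RHS](congr1 _ (invf Hh)) mpoly_actE.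
    by rewrite -lin_subst_mulmx mul_col_mx mul1mx mul0mx.
  move=> g /setDP[Gg /negPf nHg].
  rewrite linearZ /= -lin_subst_mulmx mulmxA.
  rewrite mulmx_block mul_block_col !(mulmx0, mul0mx, addr0, add0r, mul1mx).
  by rewrite iota_pi // nHg col_mx0 (lin_subst0 _ d_gt0 homf) scaler0.
rewrite /ext_coeff /ext_witness !rmorphM /= Esum split_mpoly_embed mcoeffCM.
rewrite !rmorph_prod /= (eq_bigr (fun l => 'X_l)) => [|l _].
  rewrite (_ : \prod_l 'X_l = 'X_[[multinom 1%N | _ < m]]).
    by rewrite mcoeffX eqxx mulr1.
  by rewrite mpolyXE_id; apply: eq_bigr => l _; rewrite mnmE expr1.
rewrite lin_substX big_split_ord /= big1 ?add0r => [|j _]; last first.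
  by rewrite block_mxEur mxE scale0r.
rewrite (bigD1 l) //= big1 => [|t /negPf ne_tl].
  by rewrite addr0 block_mxEdr !mxE eqxx scale1r split_mpolyXr.
by rewrite block_mxEdr !mxE ne_tl scale0r.
Qed.

End Witness.

Hypothesis nzH : #|H|%:R != 0 :> F.

(** The extension raises the degree bounds by the dimension [m] of U. *)
Lemma ext_beta_bound k s d f : beta_bound ext_repr k s ->
    (0 < d)%N -> f \is d.-homog -> invariant rW f ->
  ~ invariant_plus_pow rW k.+1 f -> (d + m <= s)%N.
Proof.
move=> bounds d_gt0 homf invf notpow; rewrite leqNgt; apply/negP=> lt_s.
apply: notpow; rewrite -[f]scale1r -(mulVf nzH) -scalerA.
apply: invariant_plus_powZ; rewrite -(ext_coeff_witness d_gt0 homf invf).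
apply: ext_coeff_pow => [l|]; first by rewrite mnmE.
apply: bounds lt_s _ _; first exact: ext_witness_homog.
exact: ext_witness_invariant.
Qed.

End Extension.

(** * Duality of finite abelian groups *)

Lemma closed_prim_root (F : closedFieldType) n :
  n%:R != 0 :> F -> exists z : F, n.-primitive_root z.
Proof.
move=> nz_n; have n_gt0 : (0 < n)%N by case: n nz_n => //; rewrite eqxx.
have [r Er] := closed_field_poly_normal ('X^n - 1 : {poly F}).
rewrite (monicP (monic_Xn_sub_1 F n_gt0)) scale1r in Er.
suff /hasP[z _ prim_z] : has n.-primitive_root r by exists z.
apply: has_prim_root => //.
- apply/allP=> z; rewrite -root_prod_XsubC -Er rootE !hornerE subr_eq0.
  by rewrite unity_rootE.
- by rewrite -separable_prod_XsubC -Er separable_Xn_sub_1.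
by rewrite -ltnS -(size_prod_XsubC r id) -Er size_XnsubC.
Qed.

(** A bimultiplicative pairing of [A] with itself, with values in the
    multiplicative group of [F], that is nondegenerate on the left: by
    [pairing_inj], a |-> [e a] embeds [A] in its character group. *)
Record dual_pairing (F : fieldType) (aT : finGroupType) (A : {set aT})
    (e : aT -> aT -> F) : Prop := DualPairing {
  pairing1l : forall b, b \in A -> e 1%g b = 1;
  pairing1r : forall a, a \in A -> e a 1%g = 1;
  pairingMl : forall b, b \in A ->
    {in A &, {morph e^~ b : x y / (x * y)%g >-> x * y}};
  pairingMr : forall a, a \in A ->
    {in A &, {morph e a : x y / (x * y)%g >-> x * y}};
  pairing_inj : forall a, a \in A -> (forall b, b \in A -> e a b = 1) -> a = 1%g
}.

Lemma cyclic_dual_pairing (F : closedFieldType) (aT : finGroupType) (x : aT) :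
  #[x]%g%:R != 0 :> F -> exists e : aT -> aT -> F, dual_pairing <[x]>%g e.
Proof.
case/closed_prim_root=> z prim_z.
(* The discrete logarithm to base x; its value outside the group generated by
   x is irrelevant. The pairing is z ^ (log a log b). *)
pose log y : nat :=
  odflt (Ordinal (order_gt0 x)) [pick i : 'I_#[x]%g | x ^+ i == y]%g.
have logK y : y \in <[x]>%g -> (x ^+ log y)%g = y.
  rewrite /log; case: pickP => [i /eqP // | no_i /cyclePmin[i lti Ey]].
  by have /eqP[] := no_i (Ordinal lti).
have eqz i j : (x ^+ i = x ^+ j)%g -> z ^+ i = z ^+ j.
  by move/eqP; rewrite eq_expg_mod_order -(eq_prim_root_expr prim_z) => /eqP.
have zlog1 : z ^+ log 1%g = 1.
  by rewrite -(expr0 z); apply: eqz; rewrite logK ?group1.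
have zlogM :
  {in <[x]>%g &, forall a b, z ^+ log (a * b)%g = z ^+ log a * z ^+ log b}.
  by move=> a b Xa Xb; rewrite -exprD; apply: eqz; rewrite expgD !logK ?groupM.
exists (fun a b => z ^+ (log a * log b)); split.
- by move=> b _; rewrite exprM zlog1 expr1n.
- by move=> a _; rewrite mulnC exprM zlog1 expr1n.
- by move=> b Xb a c Xa Xc; rewrite /= !exprM zlogM // exprMn.
- move=> b Xb a c Xa Xc /=.
  by rewrite ![(log b * _)%N]mulnC !exprM zlogM // exprMn.
(* The logarithm of x is 1 modulo the order of x, so that z ^ log a = 1 if a
   pairs trivially with x. *)
move=> a Xa /(_ x (cycle_id x)) /=.
rewrite mulnC exprM (eqz _ 1%N) ?logK ?expg1 ?cycle_id // expr1 => /eqP.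
by rewrite -(prim_order_dvd prim_z) order_dvdn logK // => /eqP.
Qed.

Lemma dprod_dual_pairing (F : fieldType) (aT : finGroupType)
    (K L A : {group aT}) (eK eL : aT -> aT -> F) :
    (K \x L)%g = A -> dual_pairing K eK -> dual_pairing L eL ->
  exists e : aT -> aT -> F, dual_pairing A e.
Proof.
move=> defA [eK1l eK1r eKMl eKMr eKI] [eL1l eL1r eLMl eLMr eLI].
have [_ defKL cKL tiKL] := dprodP defA.
have [nsKA _ _ _ _] := sdprod_context (dprodWsd defA).
have [nsLA _ _ _ _] := sdprod_context (dprodWsdC defA).
have defLK : (L * K)%g = A := etrans (centC cKL) defKL.
have tiLK : L :&: K = 1%g by rewrite setIC.
(* The projections of A to K and L. *)
pose p := remgr L K; pose q := remgr K L.
have pM : {in A &, {morph p : x y / (x * y)%g}}.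
  by apply: remgrM; rewrite ?sdprod_compl ?(dprodWsdC defA).
have qM : {in A &, {morph q : x y / (x * y)%g}}.
  by apply: remgrM; rewrite ?sdprod_compl ?(dprodWsd defA).
have pA a : a \in A -> p a \in K by rewrite -defLK; apply: mem_remgr.
have qA a : a \in A -> q a \in L by rewrite -defKL; apply: mem_remgr.
have pK a : a \in K -> p a = a by apply: remgr_id.
have qL a : a \in L -> q a = a by apply: remgr_id.
have pL a : a \in L -> p a = 1%g by apply: remgr1.
have qK a : a \in K -> q a = 1%g by apply: remgr1.
have p1 := pK 1%g (group1 K); have q1 := qL 1%g (group1 L).
exists (fun a b => eK (p a) (p b) * eL (q a) (q b)); split=> /=.
- by move=> b Ab; rewrite p1 q1 eK1l ?eL1l ?mulr1; auto.
- by move=> b Ab; rewrite p1 q1 eK1r ?eL1r ?mulr1; auto.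
- move=> b Ab x y Ax Ay; rewrite pM ?qM // eKMl ?eLMl; auto.
  by rewrite mulrACA.
- move=> b Ab x y Ax Ay; rewrite pM ?qM // eKMr ?eLMr; auto.
  by rewrite mulrACA.
move=> a Aa ea1.
have pa1 : p a = 1%g.
  apply: eKI => [|b Kb]; first exact: pA.
  have Ab := subsetP (normal_sub nsKA) b Kb.
  by have := ea1 b Ab; rewrite (pK b) // (qK b) // eL1r ?mulr1; auto.
have qa1 : q a = 1%g.
  apply: eLI => [|b Lb]; first exact: qA.
  have Ab := subsetP (normal_sub nsLA) b Lb.
  by have := ea1 b Ab; rewrite (qL b) // (pL b) // eK1r ?mul1r; auto.
rewrite -[a]pK // (divgr_eq K L a) -/q qa1 mulg1 mem_divgr //.
by rewrite defKL.
Qed.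

Lemma abelian_dual_pairing (F : closedFieldType) (aT : finGroupType)
    (A : {group aT}) :
    abelian A -> #|A|%:R != 0 :> F ->
  exists e : aT -> aT -> F, dual_pairing A e.
Proof.
case/abelian_structure=> b defA _.
elim: b A defA => [|x b IHb] A.
  rewrite big_nil => defA _; exists (fun _ _ => 1).
  split=> // [b _ | a _ | a]; rewrite -?defA ?mulr1 //.
  - by move=> x y _ _; rewrite mulr1.
  - by move=> x y _ _; rewrite mulr1.
  by move/set1P.
rewrite big_cons => defA; have [[_ L _ defL] _ _ _] := dprodP defA.
rewrite defL in defA; rewrite -(dprod_card defA) natrM mulf_eq0 negb_or.
case/andP=> /cyclic_dual_pairing[eK pairK] /(IHb L defL)[eL pairL].
exact: dprod_dual_pairing defA pairK pairL.
Qed.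


(** * The module of functions to a module of a subgroup *)

(** The functions phi from the ambient group [gT] to F^n, with the right action
    (phi g)(x) = phi(g x) of [G]. The value of phi at x has the coordinates
    indexed by the pairs (x, b). *)
Section Coinduced.
Variables (F : fieldType) (gT : finGroupType) (G H : {group gT}).
Variables (n : nat) (rW : mx_representation F H n).

Let I : finType := (gT * 'I_n)%type.
Let N := #|{: I}|.
Let pt (i : 'I_N) : I := enum_val i.

(** The action of [g] sends a function to its composite with [translate g] on
    the indices. *)
Definition translate g (i : 'I_N) : 'I_N :=
  enum_rank ((g * (pt i).1)%g, (pt i).2).

Lemma pt_translate g i : pt (translate g i) = ((g * (pt i).1)%g, (pt i).2).
Proof. exact: enum_rankK. Qed.

Lemma coind_mx_repr : mx_repr G (fun g => colsub (translate g) 1%:M : 'M[F]_N).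
Proof.
split=> [|x y _ _].
  apply/matrixP=> i j; rewrite !mxE /translate mul1g; congr (_ == _)%:R.
  by rewrite -surjective_pairing /pt enum_valK.
rewrite mulmx_colsub mulmx1; apply/matrixP=> i j; rewrite !mxE.
congr (_ == _)%:R; apply: (can_inj enum_valK).
by rewrite -!/(pt _) !pt_translate mulgA.
Qed.

Definition coind_repr := MxRepresentation coind_mx_repr.

(** The inclusion of W: w goes to the function that maps x to w x for x in [H],
    and to 0 for other x. *)
Definition coind_in : 'M[F]_(n, N) :=
  \matrix_(a, i) if (pt i).1 \in H then rW (pt i).1 a (pt i).2 else 0.

(** The retraction to W: phi goes to the average of phi(x) x^-1 for x in [H]. *)
Definition coind_out : 'M[F]_(N, n) :=
  \matrix_(i, c) if (pt i).1 \in H then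
    #|H|%:R^-1 * rW (pt i).1^-1%g (pt i).2 c else 0.

Lemma coind_inH :
  {in H, forall h, coind_in *m coind_repr h = rW h *m coind_in}.
Proof.
move=> h Hh; rewrite /= mulmx_colsub mulmx1; apply/matrixP=> a i.
rewrite !mxE pt_translate /= groupMl //; case: ifP => Hi; last first.
  by rewrite big1 // => b _; rewrite mxE Hi mulr0.
by rewrite repr_mxM // mxE; apply: eq_bigr => b _; rewrite mxE Hi.
Qed.

Hypothesis nzH : #|H|%:R != 0 :> F.

Lemma coind_in_out : {in G, forall g,
  coind_in *m coind_repr g *m coind_out = if g \in H then rW g else 0}.
Proof.
move=> g Gg; rewrite /= mulmx_colsub mulmx1; apply/matrixP=> a c.
rewrite !mxE.
pose t (p : I) := (if (g * p.1)%g \in H then rW (g * p.1)%g a p.2 else 0) *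
  (if p.1 \in H then #|H|%:R^-1 * rW p.1^-1%g p.2 c else 0).
rewrite (eq_bigr (fun i => t (pt i))) => [|i _]; last first.
  by rewrite !mxE pt_translate.
rewrite -(big_enum_val t) /= -(pair_bigA _ (fun x b => t (x, b))) /=.
rewrite (bigID (mem H)) /= addrC big1 => [|x /negPf nHx]; last first.
  by rewrite big1 // => b _; rewrite /t /= nHx mulr0.
rewrite add0r (eq_bigr (fun=> #|H|%:R^-1 * (if g \in H then rW g else 0) a c)).
  by rewrite sumr_const -[LHS]mulr_natl mulrA divff ?mul1r.
move=> x Hx; rewrite /t /= Hx groupMr //; case: ifP => Hg; last first.
  by rewrite mxE mulr0 big1 // => b _; rewrite mul0r.
rewrite -[g in RHS](mulgK x g) [in RHS]repr_mxM ?groupM ?groupV //.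
rewrite [in RHS]mxE mulr_sumr.
by apply: eq_bigr => b _; rewrite mulrCA.
Qed.

End Coinduced.

(** * Extension by an irreducible zero-sum sequence *)

Lemma prod_seq_morph (F : fieldType) (aT : finGroupType) (A : {group aT})
    (u : aT -> F) (s : seq aT) :
    u 1%g = 1 -> {in A &, {morph u : x y / (x * y)%g >-> x * y}} ->
  {subset s <= A} -> u (\prod_(x <- s) x)%g = \prod_(x <- s) u x.
Proof.
move=> u1 uM; elim: s => [|x s IHs] sA; first by rewrite !big_nil.
have sA' : {subset s <= A} by move=> y sy; rewrite sA // inE sy orbT.
rewrite !big_cons uM ?IHs //; first exact/sA/mem_head.
by rewrite big_seq; apply: group_prod => y /sA'.
Qed.

Lemma prod_mask_expr (F : fieldType) (aT : Type) (u : aT -> F) (s : seq aT)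
    (mu : 'X_{1..size s}) : (forall l, (mu l <= 1)%N) ->
  \prod_(x <- mask [tuple mu l == 1%N | l < size s] s) u x =
  \prod_l u (tnth (in_tuple s) l) ^+ mu l.
Proof.
move=> mu_le1; rewrite big_mask big_mkcond; apply: eq_bigr => l _.
rewrite -tnth_nth tnth_mktuple andbT.
by case: (mu l) (mu_le1 l) => [|[]].
Qed.

(** If [t] is not a bound for the H-module W, then some G-module has no bound
    less than [t + size s]. *)
Theorem davenport_beta_bound (F : closedFieldType) (gT : finGroupType)
    (G H : {group gT}) (k n : nat) (rW : mx_representation F H n)
    (t : nat) (s : seq (coset_of H)) :
    ([pchar F]%R^'.-group G)%g -> (H <| G)%g -> abelian (G / H)%g ->
    irreducible_zero_sum (G / H)%g s -> ~ beta_bound rW k t ->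
  exists N (rZ : mx_representation F G N),
    forall j, beta_bound rZ k j -> (t + size s <= j)%N.
Proof.
move=> charG nHG abGH [sGH s_n0 zero_s irr_s] nbound.
have [sHG nHG'] := andP nHG.
have nzH : #|H|%:R != 0 :> F by rewrite natf_neq0_pchar; apply: pgroupS charG.
have nzGH : #|G / H|%g%:R != 0 :> F.
  by rewrite natf_neq0_pchar; apply: quotient_pgroup charG.
have [e [e1l e1r eMl eMr eI]] := abelian_dual_pairing abGH nzGH.
case: s => [//|s0 s] in sGH s_n0 zero_s irr_s *.
have s0GH : s0 \in (G / H)%g by rewrite sGH ?mem_head.
have sGH' : {subset s <= (G / H)%g}.
  by move=> x sx; rewrite sGH // inE sx orbT.
pose chi g := e s0 (coset H g).
pose lam l g := e (tnth (in_tuple s) l) (coset H g).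
have tGH l : tnth (in_tuple s) l \in (G / H)%g by rewrite sGH' ?mem_tnth.
have char1 x : x \in (G / H)%g -> {in H, forall h, e x (coset H h) = 1}.
  by move=> GHx h Hh; rewrite coset_id ?e1r.
have charM x : x \in (G / H)%g ->
    {in G &, {morph (fun g => e x (coset H g)) : a b / (a * b)%g >-> a * b}}.
  move=> GHx a b Ga Gb; rewrite /= morphM ?(subsetP nHG') //.
  by rewrite eMr ?mem_quotient.
have prod_e r g : {subset r <= (G / H)%g} -> g \in G ->
    \prod_(x <- r) e x (coset H g) = e (\prod_(x <- r) x)%g (coset H g).
  move=> rGH Gg; have GHg := mem_quotient H Gg.
  rewrite -(@prod_seq_morph _ _ (G / H)%G (e^~ (coset H g))) ?e1l //.
  exact: eMl.
have chi_lam : {in G, forall g, chi g * \prod_l lam l g = 1}.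
  move=> g Gg; rewrite /lam -(big_tnth _ _ _ predT (fun x => e x (coset H g))).
  have := prod_e _ g sGH Gg; rewrite big_cons => ->.
  by rewrite [X in e X _]zero_s e1l ?mem_quotient.
(* The subsequence of s given by mu is a proper part of s0 :: s. If it has a
   trivial product of characters it has sum zero, hence it is empty. *)
have lam_free (mu : 'X_{1..size s}) : (forall l, (mu l <= 1)%N) ->
    {in G, forall g, \prod_l lam l g ^+ mu l = 1} -> mu = 0%MM.
  move=> mu_le1 lam_mu; pose b := [tuple mu l == 1%N | l < size s].
  have bGH : {subset mask b s <= (G / H)%g} by move=> x /mem_mask/sGH'.
  have zero_b : zero_sum (mask b s).
    apply: eI => [|_ /morphimP[g _ Gg ->]].
      by rewrite big_seq; apply: group_prod => x /bGH.
    rewrite -prod_e // (prod_mask_expr (fun x => e x (coset H g))) //.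
    exact: lam_mu.
  have b_nil : mask b s = [::].
    apply/eqP/contraT => b_n0; case: (irr_s (mask b s)) => //.
      exact: subseq_trans (mask_subseq b s) (subseq_cons s s0).
    apply/eqP => /(congr1 size) /= Eb.
    by have := size_subseq (mask_subseq b s); rewrite Eb ltnn.
  have: ~~ has id b.
    by rewrite has_count -(@size_mask _ _ s) ?size_tuple // b_nil.
  move/hasPn => b_false; apply/mnmP=> l; rewrite mnm0E.
  have := b_false _ (mem_tnth l b); rewrite tnth_mktuple.
  by case: (mu l) (mu_le1 l) => [|[]].
exists _, (@ext_repr _ _ _ _ _ _ (coind_repr F G n) lam
  (fun l => char1 _ (tGH l)) (fun l => charM _ (tGH l))).
move=> j bound_j; rewrite leqNgt; apply/negP=> lt_j.
apply: nbound => d f lt_d homf invf; apply: boolp.contrapT => notpow.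
have := ext_beta_bound sHG (@coind_inH _ _ G _ _ rW)
  (@coind_in_out _ _ G _ _ rW nzH) (char1 _ s0GH) (charM _ s0GH)
  chi_lam lam_free nzH bound_j (leq_ltn_trans (leq0n t) lt_d) homf invf notpow.
rewrite leqNgt => /negP[]; apply: leq_trans lt_j _.
by rewrite /= addnS -addSn leq_add2r.
Qed.

End LowerBound.

(** * The inequality of constants *)

Import reals constructive_ereal ereal.
Import Order.TTheory GRing.Theory Num.Theory.

Theorem theorem3p3 (R : realType) (F : closedFieldType) (gT : finGroupType)
    (G H : {group gT}) (k : nat)
    (charG : ([pchar F]%R^'.-group G)%g)
    (nHG : (H <| G)%g) (abGH : abelian (G / H)%g) (k_gt0 : (0 < k)%N) :
  (beta R F H k + davenport R (G / H)%g - 1 <= beta R F G k)%E.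
Proof.
have key n (rW : mx_representation F H n) t s :
    irreducible_zero_sum (G / H)%g s -> ~ beta_bound rW k t ->
    (nat_ereal R (t + size s) <= beta R F G k)%E.
  move=> irr_s nbound.
  have [N [rZ boundZ]] :=
    LowerBound.davenport_beta_bound charG nHG abGH irr_s nbound.
  apply: (@le_trans _ _ (beta_rep R k rZ)).
    apply/ereal_infP=> _ [j /boundZ le_j <-].
    by rewrite /nat_ereal lee_fin ler_nat.
  by apply: ereal_sup_ubound; exists N, rZ.
have [n0 [rW0 nbound0]] := LowerBound.trivial_not_beta_bound F H k_gt0.
(* The Davenport constant is then a supremum over the empty set. *)
have noD : (forall s, ~ irreducible_zero_sum (G / H)%g s) ->
    davenport R (G / H)%g = -oo%E.
  move=> no_s; apply/eqP; rewrite -leeNy_eq; apply: ge_ereal_sup.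
  by move=> y [s irr_s]; case: (no_s s).
move: key; case: (beta R F G k) => [r| |] key; first 1 last.
- exact: leey.
- rewrite noD ?addeNy // => s irr_s.
  by have := key n0 rW0 0%N s irr_s nbound0.
have leH s : irreducible_zero_sum (G / H)%g s ->
    (beta R F H k <= (r + 1 - (size s)%:R)%:E)%E.
  move=> irr_s; apply: ge_ereal_sup => _ [n [rW ->]].
  set x := (r + 1 - _)%R.
  (* The trivial module ensures r >= size s, so that x has an integral part. *)
  have x_ge0 : (0 <= x)%R.
    have := key n0 rW0 0%N s irr_s nbound0.
    rewrite /nat_ereal lee_fin add0n -subr_ge0 => r_ge.
    by rewrite /x addrAC addr_ge0.
  have /andP[le_x lt_x] := Num.Theory.truncn_itv x_ge0.
  apply: (@le_trans _ _ (nat_ereal R (Num.trunc x))); last by rewrite lee_fin.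
  apply: ereal_inf_lbound; exists (Num.trunc x) => //=.
  apply: boolp.contrapT => /(key _ _ _ _ irr_s); rewrite lee_fin natrD.
  rewrite leNgt -ltrBlDr => /negP[]; rewrite -(ltrD2r 1) natr1.
  by rewrite addrAC.
move: leH; case: (beta R F H k) => [b| |] leH; last by rewrite !addNye leNye.
  rewrite leeBlDr // -leeBrDl //; apply: ge_ereal_sup => _ [s irr_s <-].
  have := leH s irr_s; rewrite !lee_fin => le_b.
  by rewrite lerBrDl -lerBrDr.
by rewrite noD ?addeNy ?addNye ?leNye // => s /leH.
Qed.
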